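(* Let $k,g,\omega>0$, $m\in\mathbb{R}$, $c:=\frac{g-km^2}{2\omega}$, $U:=c-m$, and consider the wave solution whose particles are parametrized by $(a,b)$ with $a\in\mathbb{R}$, $b\le 0$, and have the paths, for $t\ge0$, $$X(t,a,b)=a+(c-m)t-\frac{e^{kb}}{k}\sin(k(a-mt)),\qquad Z(t,a,b)=b+\frac{e^{kb}}{k}\cos(k(a-mt)).$$ If $m=0$, then all the particles move horizontally eastwards with the wave speed $c=U=g/(2\omega)$. If $m\ne0$, then these equations describe waves without stagnation points.
   Context: The $X$-axis points east and the $Z$-axis upward; $g$ is the gravitational constant, $\omega$ the rotational speed of the Earth, $k$ the wave number, and $U$ the velocity of the uniform horizontal background current. The velocity of the particle $(a,b)$ at time $t$ is $(u,w)=(X_t(t,a,b),Z_t(t,a,b))$. The free surface is the curve corresponding to $b=0$; it is the graph of a function of $X-ct$, so the wave travels with velocity $c$ in the $X$-direction. Stagnation points are particles which travel horizontally with the wave speed, i.e. for which $(u,w)=(c,0)$. *)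

(* Defs.v *)
From Stdlib Require Import Reals.
From Coquelicot Require Import Coquelicot.
Open Scope R_scope.

(* Lagrangian description: a function [F t a b] gives a coordinate at time [t]
   of the particle labelled [(a, b)], with [b <= 0] and [b = 0] on the free
   surface. *)
Definition pathX (k m c t a b : R) : R :=
  a + (c - m) * t - exp (k * b) / k * sin (k * (a - m * t)).

Definition pathZ (k m t a b : R) : R :=
  b + exp (k * b) / k * cos (k * (a - m * t)).

Definition velocity (X Z : R -> R -> R -> R) (t a b : R) : R * R :=
  (Derive (fun s => X s a b) t, Derive (fun s => Z s a b) t).

(* A stagnation point is a particle, not an event: the identity
   (u, w) = (c, 0) is required along its whole path.  (At isolated instants it
   does hold for surface particles passing through a crest, e.g. a = b = t = 0,
   whatever the value of m.) *)
Definition stagnation_point (X Z : R -> R -> R -> R) (c a b : R) : Prop :=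
  forall t : R, 0 <= t -> velocity X Z t a b = (c, 0).

(* The free surface is a non-flat graph over the horizontal axis, translated
   horizontally with velocity [c]. *)
Definition travelling_wave (X Z : R -> R -> R -> R) (c : R) : Prop :=
  exists eta : R -> R,
    (exists x y : R, eta x <> eta y) /\
    (forall t x z : R, 0 <= t ->
       ((exists a : R, x = X t a 0 /\ z = Z t a 0) <-> z = eta (x - c * t))).

(* Main.v *)
(** In the frame moving with speed [c], the surface particle [(a, 0)] has
    abscissa [F (k (a - m t)) / k] with [F x = x - sin x].  The map [F] is a
    bijection of the line because [|sin x - sin y| < |x - y|] for [x <> y], so
    the profile is [eta s = cos (F^-1 (k s)) / k].  A stagnation point would
    have zero vertical velocity, that is [sin (k (a - m t)) = 0], at all
    times, which fails a quarter period after [t = 0]. *)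
Require Import Defs.
From Stdlib Require Import Reals Lra.
From Coquelicot Require Import Coquelicot.
Open Scope R_scope.

(** The drift [c - m] plus a rotating vector of length [|m| * exp (k * b)]. *)
Lemma velocity_path (k m c t a b : R) : k <> 0 ->
  velocity (pathX k m c) (pathZ k m) t a b =
  (c - m + m * exp (k * b) * cos (k * (a - m * t)),
   m * exp (k * b) * sin (k * (a - m * t))).
Proof.
  intros hk; unfold velocity, pathX, pathZ.
  f_equal; apply is_derive_unique; auto_derive; trivial;
    fold (Rminus a (m * t)); now field.
Qed.

(** By sum-to-product, [sin y - sin x] is [2 * cos ((y + x) / 2) * sin d] with [d] half the gap, and
    [|sin d| < d]. This stays strict where the derivative [1 - cos x] vanishes. *)
Lemma sub_sin_increasing (x y : R) : x < y -> x - sin x < y - sin y.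
Proof.
  intros hxy.
  assert (hsin : sin y - sin x < y - x); [| lra].
  rewrite form4.
  set (d := (y - x) / 2).
  assert (hd : 0 < d) by (unfold d; lra).
  replace (y - x) with (2 * d) by (unfold d; field).
  pose proof (sin_lt_x d hd).
  (* [sin d] may be negative, so both bounds [|sin d| < d] are needed. *)
  assert (- d < sin d).
  { destruct (Rle_lt_dec d PI) as [h | h].
    - pose proof (sin_ge_0 d ltac:(lra) h); lra.
    - pose proof (SIN_bound d); pose proof PI2_1; lra. }
  pose proof (COS_bound ((y + x) / 2)).
  destruct (Rle_lt_dec 0 (sin d)); nra.
Qed.

Lemma sub_sin_injective (x y : R) : x - sin x = y - sin y -> x = y.
Proof.
  intros h.
  destruct (Rtotal_order x y) as [hlt | [heq | hgt]]; trivial.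
  - pose proof (sub_sin_increasing x y hlt); lra.
  - pose proof (sub_sin_increasing y x hgt); lra.
Qed.

Lemma sub_sin_surjective (y : R) : {x : R | x - sin x = y}.
Proof.
  (* Since [|sin| <= 1], the function is [<= 0] at [y - 1] and [>= 0] at [y + 1]. *)
  destruct (IVT_cor (fun x => x - sin x - y) (y - 1) (y + 1))
    as [x [_ hx]].
  - intros x; apply derivable_continuous_pt.
    exists (1 - cos x); apply is_derive_Reals.
    auto_derive; trivial; ring.
  - lra.
  - pose proof (SIN_bound (y - 1)); pose proof (SIN_bound (y + 1)); nra.
  - exists x; lra.
Qed.

Definition sub_sin_inv (y : R) : R := proj1_sig (sub_sin_surjective y).

Lemma sub_sin_invK (y : R) : sub_sin_inv y - sin (sub_sin_inv y) = y.
Proof. exact (proj2_sig (sub_sin_surjective y)). Qed.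

Lemma sub_sinK (x : R) : sub_sin_inv (x - sin x) = x.
Proof. apply sub_sin_injective, sub_sin_invK. Qed.

Lemma travelling_wave_path (k m c : R) : 0 < k ->
  travelling_wave (pathX k m c) (pathZ k m) c.
Proof.
  intros hk.
  exists (fun s => cos (sub_sin_inv (k * s)) / k); split.
  (* Crest and trough: [x - sin x] fixes [0] and [PI], so the profile takes the values [1 / k] and
     [- 1 / k] there. *)
  - exists 0, (PI / k).
    replace (k * 0) with (0 - sin 0) by (rewrite sin_0; ring).
    replace (k * (PI / k)) with (PI - sin PI) by (rewrite sin_PI; field; lra).
    rewrite !sub_sinK, cos_0, cos_PI.
    pose proof (Rinv_0_lt_compat k hk); lra.
  - intros t x z _; unfold pathX, pathZ.
    rewrite Rmult_0_r, exp_0; split.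
    + intros [a [-> ->]].
      replace (k * (_ - c * t)) with (k * (a - m * t) - sin (k * (a - m * t)))
        by (field; lra).
      rewrite sub_sinK; field; lra.
    + intros ->.
      (* The label [a] whose phase [k * (a - m * t)] is the preimage of [k * (x - c * t)]. *)
      exists (sub_sin_inv (k * (x - c * t)) / k + m * t).
      replace (k * (_ / k + m * t - m * t)) with (sub_sin_inv (k * (x - c * t)))
        by (field; lra).
      pose proof (sub_sin_invK (k * (x - c * t))) as hinv.
      split; [| field; lra].
      apply (Rmult_eq_reg_l k); [| lra].
      transitivity (k * (x - c * t) + k * c * t); [ring |].
      rewrite <- hinv at 1; field; lra.
Qed.

Lemma no_stagnation_point (k m c a b : R) : 0 < k -> m <> 0 ->
  ~ stagnation_point (pathX k m c) (pathZ k m) c a b.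
Proof.
  intros hk hm hstag.
  assert (hsin : forall t, 0 <= t -> sin (k * (a - m * t)) = 0).
  { intros t ht; specialize (hstag t ht).
    rewrite velocity_path in hstag by lra.
    injection hstag as _ hw.
    pose proof (exp_pos (k * b)).
    apply Rmult_integral in hw; destruct hw as [hw | hw]; trivial.
    apply Rmult_integral in hw; destruct hw; lra. }
  pose proof (hsin 0 (Rle_refl 0)) as h0.
  replace (k * (a - m * 0)) with (k * a) in h0 by ring.
  assert (hcos : cos (k * a) = 0).
  { pose proof (Rabs_pos_lt m hm).
    (* At this time the phase has moved by [PI / 2], down or up with the sign of [m], so its sine is
       [cos (k * a)] up to sign. *)
    assert (hpos : 0 <= PI / 2 / (k * Rabs m)).
    { apply Rlt_le, Rdiv_lt_0_compat; [pose proof PI_RGT_0; lra | nra]. }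
    specialize (hsin _ hpos).
    destruct (Rcase_abs m) as [hneg | hnonneg].
    - rewrite Rabs_left in hsin by trivial.
      replace (k * _) with (k * a + PI / 2) in hsin by (field; lra).
      rewrite sin_plus, sin_PI2, cos_PI2 in hsin; lra.
    - rewrite Rabs_right in hsin by trivial.
      replace (k * _) with (k * a - PI / 2) in hsin by (field; lra).
      rewrite sin_minus, sin_PI2, cos_PI2 in hsin; lra. }
  pose proof (sin2_cos2 (k * a)) as h1.
  rewrite h0, hcos in h1; unfold Rsqr in h1; lra.
Qed.

Theorem proposition4p3 (k g omega m c U : R)
  (hk : 0 < k) (hg : 0 < g) (homega : 0 < omega)
  (hc : c = (g - k * m ^ 2) / (2 * omega)) (hU : U = c - m) :
  (m = 0 ->
     c = U /\ U = g / (2 * omega) /\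
     0 < c /\
     (forall a b t : R, b <= 0 -> 0 <= t ->
        velocity (pathX k m c) (pathZ k m) t a b = (c, 0))) /\
  (m <> 0 ->
     travelling_wave (pathX k m c) (pathZ k m) c /\
     (forall a b : R, b <= 0 ->
        ~ stagnation_point (pathX k m c) (pathZ k m) c a b)).
Proof.
  split; intros hm.
  - assert (hcg : c = g / (2 * omega)) by (rewrite hc, hm; field; lra).
    repeat split.
    + lra.
    + lra.
    (* Positivity of [c] is what makes the motion eastward. *)
    + rewrite hcg; apply Rdiv_lt_0_compat; lra.
    + intros a b t _ _.
      rewrite velocity_path by lra.
      rewrite hm; f_equal; ring.
  - split.
    + now apply travelling_wave_path.
    + intros a b _; now apply no_stagnation_point.
Qed.
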